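(* Let $K$ be a compact plane set that contains the origin, let $\sqrt{K}=\{z\in\mathbb{C}: z^2\in K\}$, and let $m\in\mathbb{N}$. \begin{enumerate} \item[(a)] If $z^m\in\overline{J_0(R(K))}$, then $z^{2m}\in\overline{J_0(R(\sqrt{K}))}$. \item[(b)] If $\overline{J_0(R(K))}\supset M_0(R(K))^m$, then $\overline{J_0(R(\sqrt{K}))}\supset M_0(R(\sqrt{K}))^{2m}$. \item[(c)] If $R(K)$ has a nondegenerate bounded point derivation of order $m$ at the origin, then $R(\sqrt{K})$ has a nondegenerate bounded point derivation of order $2m$ at the origin. \end{enumerate}
   Context: $\mathbb{N}=\{1,2,\dots\}$. A compact plane set is a nonempty compact subset of $\mathbb{C}$. For a compact plane set $K$, $R(K)$ is the uniform closure on $K$ of the rational functions with poles off $K$ (a closed subalgebra of $C(K)$ with the sup norm). Here $z$ denotes the coordinate function. For a closed subalgebra $A$ of $C(X)$ (a uniform algebra on $X$) and $x\in X$: $M_x(A)=\{f\in A:f(x)=0\}$, $J_x(A)=\{f\in A: f^{-1}(0)\text{ contains a neighborhood of }x\text{ in }X\}$. Bars denote closure in $A$. $M_x(A)^m$ is the usual $m$th power of the ideal (the linear span of products of $m$ elements). A point derivation of order $m$ on $A$ at a complex homomorphism $\phi$ is a sequence $(d^{(k)})_{k=0}^m$ of linear functionals on $A$ with $d^{(0)}=\phi$ and $d^{(k)}(fg)=\sum_{j=0}^k d^{(j)}(f)\,d^{(k-j)}(g)$ for all $f,g\in A$ and all $1\le k\le m$. It is bounded if every $d^{(k)}$ is bounded,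 and nondegenerate if $d^{(1)}\neq0$. A point derivation at a point $a$ is one at the evaluation functional $f\mapsto f(a)$. *)

(* Defs.v *)
From HB Require Import structures.
From mathcomp Require Import all_boot all_order all_algebra.
From mathcomp Require Import all_classical all_reals all_analysis.
From mathcomp Require Import complex.

Set Implicit Arguments.
Unset Strict Implicit.
Unset Printing Implicit Defensive.

Import Order.TTheory GRing.Theory Num.Theory.
Import numFieldNormedType.Exports.
Local Open Scope classical_set_scope.
Local Open Scope ring_scope.

(* The usual topology and norm on the complex numbers: those of [R[i]] seen as
   a normed field, transferred from the regular module [R[i]^o]. *)
HB.instance Definition _ (R : realType) := NormedModule.copy R[i] R[i]^o.

Section UniformAlgebras.
Context {R : realType} {X : topologicalType}.
Implicit Types (A J : set (X -> R[i])) (f : X -> R[i]).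

(* The real number sup_x |f x|. It is the sup norm for bounded [f] only:
   [sup] is 0 on sets that have no upper bound. *)
Definition supnorm f : R := sup [set ComplexField.Normc.normc (f x) | x in [set: X]].

Definition uniform_closure A : set (X -> R[i]) :=
  closure (A : set {uniform X -> R[i]}).

Definition closure_in A J : set (X -> R[i]) := A `&` uniform_closure J.

Definition Mideal A (x : X) : set (X -> R[i]) := [set f | A f /\ f x = 0].

Definition Jideal A (x : X) : set (X -> R[i]) :=
  [set f | A f /\ \forall y \near x, f y = 0].

(* Meaningful as an ideal power for [0 < m] only. *)
Definition ideal_pow J (m : nat) : set (X -> R[i]) :=
  [set f | exists (n : nat) (c : 'I_n -> R[i]) (g : 'I_n -> 'I_m -> X -> R[i]),
     (forall i j, J (g i j)) /\
     f = \sum_(i < n) c i *: \prod_(j < m) g i j].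

(* A functional on [A] is represented by a total function on [X -> R[i]];
   every condition below only concerns its values on [A]. *)
Definition linear_on A (d : (X -> R[i]) -> R[i]) : Prop :=
  forall (a : R[i]) f g, A f -> A g -> d (a *: f + g) = a * d f + d g.

Definition bounded_on A (d : (X -> R[i]) -> R[i]) : Prop :=
  exists M : R,
    forall f, A f -> ComplexField.Normc.normc (d f) <= M * supnorm f.

(* The sequence (d^(0), ..., d^(m)); the values [d k] for [k > m] are junk. *)
Definition point_derivation A (phi : (X -> R[i]) -> R[i]) (m : nat)
    (d : nat -> (X -> R[i]) -> R[i]) : Prop :=
  [/\ forall k, (k <= m)%N -> linear_on A (d k),
      forall f, A f -> d 0%N f = phi f
    & forall k f g, (1 <= k <= m)%N -> A f -> A g ->
        d k (f * g) = \sum_(j < k.+1) d j f * d (k - j)%N g].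

Definition bounded_derivation A (m : nat) (d : nat -> (X -> R[i]) -> R[i]) :
    Prop :=
  forall k, (k <= m)%N -> bounded_on A (d k).

Definition nondegenerate A (d : nat -> (X -> R[i]) -> R[i]) : Prop :=
  exists2 f, A f & d 1%N f != 0.

Definition has_nondeg_bounded_derivation A (m : nat) (x : X) : Prop :=
  exists d : nat -> (X -> R[i]) -> R[i],
    [/\ point_derivation A (fun f => f x) m d,
        bounded_derivation A m d
      & nondegenerate A d].

End UniformAlgebras.

Section PlaneSets.
Context {R : realType}.
Implicit Type K : set R[i].

Definition zfun K : K -> R[i] := fun x => val x.
Arguments zfun : clear implicits.

Definition rational_fun K : set (K -> R[i]) :=
  [set f | exists p q : {poly R[i]},
     (forall x : K, q.[val x] != 0) /\
     (forall x : K, f x = p.[val x] / q.[val x])].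
Arguments rational_fun : clear implicits.

(* [K] as a type carries the subspace topology. Uniform limits of continuous
   functions being continuous, the closure may be taken among all functions. *)
Definition RK K : set (K -> R[i]) := uniform_closure (rational_fun K).
Arguments RK : clear implicits.

Definition sqrt_set K : set R[i] := [set z | K (z ^+ 2)].

Lemma sqrt_set0 K : K 0 -> sqrt_set K 0.
Proof. by rewrite /sqrt_set /= expr0n. Qed.

Definition origin K (K0 : K 0) : K := SigSub (mem_set K0).

End PlaneSets.

Arguments zfun {R} K.
Arguments rational_fun {R} K.
Arguments RK {R} K.

(* Main.v *)
Require Import Defs.
From mathcomp Require Import all_boot all_order all_algebra.
From mathcomp Require Import all_classical all_reals all_analysis.
From mathcomp Require Import complex.
From mathcomp Require Import ring.

(** Write S for the square root of K and E f for the even part of a function f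
on S, read as a function of w = z^2 on K. The pullback a |-> a(z^2) embeds R(K)
into R(S), and E is a left inverse of it of norm one that is R(K)-linear. Both
maps send rational functions to rational functions: the common denominator
q(z) q(-z) is a polynomial in z^2 without zeros on K. Hence both maps exist on
the uniform closures. Everything about S is thus transported to K through the
even part and the pullback.

(a) The pullback maps J_0(R(K)) into J_0(R(S)), is an isometry, and sends z^m
to z^(2m).

(b) Split f and g in M_0(R(S)) into even and odd parts. The products of two
even or of two odd parts are pullbacks of elements of M_0(R(K)), and each mixed
product has one such pullback as a factor. So a product of 2m elements, grouped
into m pairs, is a combination with coefficients in R(S) of pullbacks of
products of m elements of M_0(R(K)), all of which lie in the closed ideal
obtained as the closure of J_0(R(S)): [closure_Jideal_prod].

(c) A nondegenerate bounded derivation of order m at 0 is the same thing as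
bounded linear functionals c_0, ..., c_m extending the Taylor coefficients
f |-> f^(k)(0) / k! of rational functions. These are characterised by
c_0 f = f(0), c_k 1 = 0 for k > 0 and c_(k+1) (z f) = c_k f, which is the
notion of [taylor_system]. A derivation d satisfies
d_k f = \sum_(i <= k) c_i f * d_k (z^i), a triangular system with diagonal
entries (d_1 z)^k, and d_1 z <> 0 because otherwise d_1 would vanish on rational
functions, so the c_i can be solved for ([taylor_of_derivation]). Conversely
the recursion determines the Taylor coefficients of polynomials, then of
quotients, and the Leibniz rule passes to R(K) by density
([derivation_of_taylor]). On S, the coefficient of z^(2j) in f is the j-th one of
E f, and the coefficient of z^(2j-1) in f is the coefficient of z^(2j) in z f,
that is the j-th one of E (z f); this gives a system of order 2m
([sqrt_taylorP]). *)

Set Implicit Arguments.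
Unset Strict Implicit.
Unset Printing Implicit Defensive.

Import Order.TTheory GRing.Theory Num.Theory.
Import numFieldNormedType.Exports.
Local Open Scope classical_set_scope.
Local Open Scope ring_scope.

Local Notation nc := ComplexField.Normc.normc.

(** * Uniform closures and rational functions *)

Section Modulus.
Context {R : realType}.
Implicit Types x y : R[i].

Lemma norm_ncE x : `|x| = (nc x)%:C%C. Proof. by []. Qed.

Lemma nc_ge0 x : 0 <= nc x.
Proof. by have := normr_ge0 x; rewrite norm_ncE ler0c. Qed.

Lemma ncD x y : nc (x + y) <= nc x + nc y. Proof. exact: le_normcD. Qed.

Lemma ncM x y : nc (x * y) = nc x * nc y.
Proof. exact: ComplexField.Normc.normcM. Qed.

Lemma ncN x : nc (- x) = nc x. Proof. exact: (@normcN R). Qed.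

Lemma nc0 : nc (0 : R[i]) = 0. Proof. exact: ComplexField.Normc.normc0. Qed.

Lemma nc_half x y : nc ((x + y) / 2) <= (nc x + nc y) / 2.
Proof.
have n2 : nc (2^-1 : R[i]) = 2^-1.
  apply: complexI; rewrite -norm_ncE ger0_norm ?invr_ge0 ?ler0n//.
  by rewrite fmorphV rmorph_nat.
by rewrite ncM n2 ler_wpM2r ?invr_ge0 ?ler0n// ncD.
Qed.

End Modulus.

Section UniformClosure.
Context {R : realType}.

(** Reduces the topology of uniform convergence, whose entourages are indexed
    by positive elements of [R[i]], to real epsilons. *)
Lemma uniform_closureP (X : topologicalType)
    (A : set (X -> R[i])) (f : X -> R[i]) :
  uniform_closure A f <->
  forall e : R, 0 < e -> exists2 g, A g & forall x, nc (f x - g x) <= e.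
Proof.
split=> [cf e e0|cf B].
  pose E := [set xy : R[i] * R[i] | ball xy.1 e%:C%C xy.2].
  have entE : entourage E by rewrite -entourage_ballE; exists e%:C%C => //=; rewrite ltcR.
  have /cf [g [/= Ag Bg]] : nbhs (f : {uniform X -> R[i]})
     [set h : {uniform X -> R[i]} | forall y, E (f y, h y)].
    apply/uniform_nbhs; exists E; split => // h /= Eh y; exact: Eh.
  exists g => // x; have := Bg x.
  rewrite /E /= -ball_normE /= norm_ncE ltcR; exact: ltW.
move=> /uniform_nbhs [E [entE /= EB]].
have [/= e e0 eE] :
    exists2 e : R, 0 < e & forall x y : R[i], nc (x - y) <= e -> E (x, y).
  have [[a b]/= e0 eE] :
      exists2 e : R[i], 0 < e & forall x y : R[i], ball x e y -> E (x, y).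
    have := entE; rewrite -entourage_ballE => -[e /= e0 eE]; exists e => // x y xy.
    by apply: eE => /=.
  have := e0; rewrite ltcE /= => /andP[/eqP b0 a0].
  exists (a/2); first by rewrite divr_gt0.
  move=> x y xy; apply: eE; rewrite -ball_normE /= norm_ncE.
  rewrite b0 ltcR (le_lt_trans xy)// ltr_pdivrMr// ltr_pMr// ltr1n//.
have [g Ag fg] := cf _ e0.
exists g; split => //; apply: EB => y /= _; exact: eE.
Qed.

Lemma uniform_closure_sub (X : topologicalType) (A : set (X -> R[i])) :
  A `<=` uniform_closure A.
Proof. by move=> f Af; exact: (@subset_closure {uniform X -> R[i]}). Qed.

(** A Lipschitz map need only be tested on a dense set. Multiplication by a
    bounded function, the pullback and the even part are instances. *)
Lemma uniform_closure_map (X Y : topologicalType) (A : set (X -> R[i]))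
    (B : set (Y -> R[i])) (T : (X -> R[i]) -> Y -> R[i]) (c : R) :
  (forall f g e, (forall x, nc (f x - g x) <= e) ->
     forall y, nc (T f y - T g y) <= c * e) ->
  A `<=` T @^-1` uniform_closure B ->
  uniform_closure A `<=` T @^-1` uniform_closure B.
Proof.
move=> lipT TAB f /uniform_closureP cf; apply/uniform_closureP => e e0.
have c1 : 0 < `|c| + 1 by rewrite ltr_wpDl.
have [g Ag fg] := cf (e / 2 / (`|c| + 1)) ltac:(by rewrite !divr_gt0).
have [h Bh gh] :=
  (iffLR (uniform_closureP _ _) (TAB g Ag)) (e / 2) ltac:(by rewrite divr_gt0).
exists h => // y.
have -> : T f y - h y = (T f y - T g y) + (T g y - h y) by rewrite addrA subrK.
rewrite (le_trans (ncD _ _))// [leRHS]splitr lerD//.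
rewrite (le_trans (lipT _ _ _ fg y))// mulrA ler_pdivrMr// [c * _]mulrC.
by rewrite ler_pM2l ?divr_gt0// (le_trans (ler_norm _))// lerDl.
Qed.

End UniformClosure.

Section RationalFunctions.
Context {R : realType}.
Implicit Types K : set R[i].

Definition polyfun K (p : {poly R[i]}) : K -> R[i] := fun x => p.[val x].

Definition nc_bounded (X : Type) (f : X -> R[i]) : Prop :=
  exists M : R, forall x, nc (f x) <= M.

(** The form in which compactness enters: it makes [RK K] an algebra of bounded
    functions, and it passes to the square root by algebra alone, see
    [sqrt_rational_bounded]. *)
Definition rational_bounded K : Prop :=
  rational_fun K `<=` @nc_bounded K.

Lemma rational_polyfun K p : rational_fun K (polyfun p).
Proof.
by exists p, 1; split=> x; rewrite ?hornerE ?oner_neq0// /polyfun divr1.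
Qed.

Lemma rationalD K f g :
  rational_fun K f -> rational_fun K g -> rational_fun K (f + g).
Proof.
move=> [p [q [q0 fE]]] [p' [q' [q'0 gE]]].
exists (p * q' + p' * q), (q * q'); split=> x.
  by rewrite hornerM mulf_neq0.
by rewrite !hornerE fctE fE gE addf_div.
Qed.

Lemma rationalM K f g :
  rational_fun K f -> rational_fun K g -> rational_fun K (f * g).
Proof.
move=> [p [q [q0 fE]]] [p' [q' [q'0 gE]]].
exists (p * p'), (q * q'); split=> x.
  by rewrite hornerM mulf_neq0.
by rewrite !hornerE fctE fE gE mulf_div.
Qed.

Lemma continuous_hornerC (p : {poly R[i]}) : continuous (horner p).
Proof.
elim/poly_ind: p => [|p c IH] x.
  rewrite (_ : horner 0 = fun=> 0); first exact: cst_continuous.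
  by apply/funext => y; rewrite horner0.
rewrite (_ : horner _ = fun y => p.[y] * y + c); last first.
  by apply/funext => y; rewrite !hornerE.
apply: (@continuousD _ _ _ (fun y => p.[y] * y) (fun=> c)); last exact: cst_continuous.
by apply: (@continuousM _ _ (horner p) id); [exact: IH|exact: cvg_id].
Qed.

(** A quotient with nonvanishing denominator is continuous, hence locally
    bounded, and compactness makes the bounds uniform. *)
Lemma compact_rational_bounded K : compact K -> rational_bounded K.
Proof.
move=> /compact_near_coveringP cK f [p [q [q0 fE]]].
pose h z := p.[z] / q.[z].
have [M [_ hM]] : \forall M \near +oo, K `<=` (fun z => nc (h z) <= M).
  apply: (cK R +oo (fun M z => nc (h z) <= M)) => x Kx.
  have hx : h z @[z --> x] --> h x.
    have qx : q.[x] != 0 by exact: (q0 (SigSub (mem_set Kx))).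
    apply: (@continuousM _ _ (horner p) (fun z => q.[z]^-1)).
      exact: continuous_hornerC.
    by apply: (@continuousV _ _ (horner q)) => //; exact: continuous_hornerC.
  have dx := cvgr_dist_lt _ _ hx _ ltr01.
  (* any bound beyond nc (h x) + 1 is good near x *)
  near=> z M => /=.
  have -> : h z = - (h x - h z) + h x by rewrite opprB subrK.
  apply: le_trans (ncD _ _) _; rewrite ncN.
  have /ltW z1 : nc (h x - h z) < 1 by rewrite -ltcR -norm_ncE; near: z; exact: dx.
  apply: (@le_trans _ _ (1 + nc (h x))); first by rewrite lerD2r.
  near: M; exact: nbhs_pinfty_ge (num_real _).
have Mp : M < `|M| + 1 by rewrite ltr_pwDr ?ler_norm.
exists (`|M| + 1) => x; rewrite fE; exact: (hM _ Mp (val x) (set_valP x)).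
Unshelve. all: by end_near.
Qed.

End RationalFunctions.

(** * The algebra structure of R(K) *)

Section ClosureAlgebra.
Context {R : realType} {X : topologicalType}.
Implicit Types (A B C : set (X -> R[i])) (f g h : X -> R[i]).

Lemma uniform_closureD A B C f g :
  (forall u v, A u -> B v -> C (u + v)) ->
  uniform_closure A f -> uniform_closure B g -> uniform_closure C (f + g).
Proof.
move=> ABC /uniform_closureP Af /uniform_closureP Bg.
apply/uniform_closureP => e e0; have e20 : 0 < e / 2 by rewrite divr_gt0.
have [u Au fu] := Af _ e20; have [v Bv gv] := Bg _ e20.
exists (u + v) => [|x]; first exact: ABC.
by rewrite !fctE opprD addrACA (le_trans (ncD _ _))// [leRHS]splitr lerD.
Qed.

Lemma uniform_closureMl A B h f :
  nc_bounded h -> (forall g, A g -> uniform_closure B (h * g)) ->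
  uniform_closure A f -> uniform_closure B (h * f).
Proof.
move=> [M hM] AB; move: f.
apply: (@uniform_closure_map _ _ _ _ _ (fun f => h * f) M) => // f g e fg x.
by rewrite !fctE -mulrBr ncM ler_pM// nc_ge0.
Qed.

Lemma nc_bounded_closure A f :
  A `<=` @nc_bounded R X -> uniform_closure A f -> nc_bounded f.
Proof.
move=> Ab /uniform_closureP/(_ 1 ltr01)[g /Ab[M gM] fg].
exists (1 + M) => x; rewrite -[f x](subrK (g x)).
by rewrite (le_trans (ncD _ _))// lerD.
Qed.

End ClosureAlgebra.

Section SupNorm.
Context {R : realType} {X : topologicalType}.
Implicit Types f : X -> R[i].

Lemma nc_le_supnorm f x : nc_bounded f -> nc (f x) <= supnorm f.
Proof.
move=> [M fM]; apply: ub_le_sup; last by exists x.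
by exists M => _ [y _ <-].
Qed.

Lemma supnorm_le f (M : R) : X -> (forall x, nc (f x) <= M) -> supnorm f <= M.
Proof.
move=> x fM; apply: sup_le_ub; first by exists (nc (f x)), x.
by move=> _ [y _ <-].
Qed.

End SupNorm.

Section RKAlgebra.
Context {R : realType} (K : set R[i]).
Context (Kb : rational_bounded K).
Implicit Types f g : K -> R[i].

Lemma RK_polyfun p : RK K (polyfun p).
Proof. exact/uniform_closure_sub/rational_polyfun. Qed.

Lemma RK_bounded : RK K `<=` @nc_bounded R K.
Proof. by move=> f; exact: nc_bounded_closure. Qed.

Lemma RKD f g : RK K f -> RK K g -> RK K (f + g).
Proof. by apply: uniform_closureD; exact: rationalD. Qed.

(** Multiplication by a bounded function is Lipschitz. First the factor [g] is
    approximated with [f] fixed, then [f] with [g] rational. *)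
Lemma RKM f g : RK K f -> RK K g -> RK K (f * g).
Proof.
move=> Kf; apply: uniform_closureMl => [|h Kh]; first exact: RK_bounded.
rewrite mulrC; move: Kf; apply: uniform_closureMl => [|k Kk]; first exact: Kb.
exact/uniform_closure_sub/rationalM.
Qed.

Lemma polyfunC c : polyfun c%:P = (fun=> c) :> (K -> R[i]).
Proof. by apply/funext => x; rewrite /polyfun hornerC. Qed.

Lemma polyfun1 : polyfun 1 = 1 :> (K -> R[i]).
Proof. by rewrite polyfunC. Qed.

Lemma polyfunX : polyfun 'X = zfun K.
Proof. by apply/funext => x; rewrite /polyfun hornerX. Qed.

Lemma polyfunD p q : polyfun (p + q) = polyfun p + polyfun q :> (K -> R[i]).
Proof. by apply/funext => x; rewrite /polyfun fctE hornerD. Qed.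

Lemma polyfunM p q : polyfun (p * q) = polyfun p * polyfun q :> (K -> R[i]).
Proof. by apply/funext => x; rewrite /polyfun fctE hornerM. Qed.

Lemma polyfunXn n : polyfun ('X^n) = zfun K ^+ n.
Proof. by apply/funext => x; rewrite /polyfun hornerXn fctE. Qed.

Lemma scale_polyfun c f : c *: f = polyfun c%:P * f.
Proof. by apply/funext => x; rewrite polyfunC !fctE. Qed.

Lemma RK1 : RK K 1.
Proof. by rewrite -polyfun1; exact: RK_polyfun. Qed.

Lemma RKz : RK K (zfun K).
Proof. by rewrite -polyfunX; exact: RK_polyfun. Qed.

Lemma RKZ c f : RK K f -> RK K (c *: f).
Proof. by move=> Kf; rewrite scale_polyfun; apply: RKM => //; exact: RK_polyfun. Qed.

Lemma RKB f g : RK K f -> RK K g -> RK K (f - g).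
Proof. by move=> Kf Kg; rewrite -scaleN1r; apply: RKD => //; exact: RKZ. Qed.

End RKAlgebra.

(** * The squaring map and even parts *)

Section SquareRoot.
Context {R : realType} (K : set R[i]).
Local Notation S := (sqrt_set K).
Implicit Types (f g : S -> R[i]) (a b : K -> R[i]).

Lemma sq_sqrt_set (z : S) : K (val z ^+ 2).
Proof. exact: (set_valP z). Qed.

Definition sq_pt (z : S) : K := SigSub (mem_set (sq_sqrt_set z)).

Lemma sqrt_set_sqrtC (w : K) : S (sqrtC (val w)).
Proof. by rewrite /sqrt_set /= sqrtCK; exact: set_valP. Qed.

Definition sqrt_pt (w : K) : S := SigSub (mem_set (sqrt_set_sqrtC w)).

Lemma sqrt_setN (z : S) : S (- val z).
Proof. by rewrite /sqrt_set /= sqrrN; exact: sq_sqrt_set. Qed.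

Definition opp_pt (z : S) : S := SigSub (mem_set (sqrt_setN z)).

Lemma val_sq_pt z : val (sq_pt z) = val z ^+ 2. Proof. by []. Qed.

Lemma val_opp_pt z : val (opp_pt z) = - val z. Proof. by []. Qed.

Lemma sqrt_ptK : cancel sqrt_pt sq_pt.
Proof. by move=> w; apply: val_inj; rewrite val_sq_pt /= sqrtCK. Qed.

Lemma opp_ptK : involutive opp_pt.
Proof. by move=> z; apply: val_inj; rewrite /= opprK. Qed.

Lemma sq_pt_opp z : sq_pt (opp_pt z) = sq_pt z.
Proof. by apply: val_inj; rewrite /= sqrrN. Qed.

Lemma sqrt_sq_pt z : sqrt_pt (sq_pt z) = z \/ sqrt_pt (sq_pt z) = opp_pt z.
Proof.
have /eqP := sqrtCK (val z ^+ 2); rewrite eqf_sqr => /orP[]/eqP e; [left|right];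
by apply: val_inj; rewrite /= e.
Qed.

Definition pullback a : S -> R[i] := a \o sq_pt.

(** The choice of the square root does not matter, since the two roots of a
    point are opposite; the result is a function on [K], not on its square
    root. *)
Definition even_part f : K -> R[i] :=
  fun w => (f (sqrt_pt w) + f (opp_pt (sqrt_pt w))) / 2.

Lemma pullback_even_part f z :
  pullback (even_part f) z = (f z + f (opp_pt z)) / 2.
Proof.
rewrite /pullback /even_part /=.
by have [->|->] := sqrt_sq_pt z; rewrite // opp_ptK addrC.
Qed.

Lemma even_partM a f : even_part (pullback a * f) = a * even_part f.
Proof.
apply/funext => w; rewrite /even_part !fctE /pullback /= sq_pt_opp sqrt_ptK.
by rewrite -mulrDr mulrA.
Qed.

Lemma even_part_pullback a : even_part (pullback a) = a.
Proof.
rewrite -[pullback a]mulr1 even_partM; apply/funext => w.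
by rewrite /even_part !fctE -[1 + 1]/(2%:R) divff ?mulr1// pnatr_eq0.
Qed.

Lemma even_part_linear c f g :
  even_part (c *: f + g) = c *: even_part f + even_part g.
Proof.
apply/funext => w; rewrite /even_part !fctE /GRing.scale /=.
by rewrite addrACA -mulrDr mulrDl mulrA.
Qed.

Lemma pullback_z : pullback (zfun K) = zfun S ^+ 2.
Proof. by apply/funext => z; rewrite fctE. Qed.

Lemma even_part_z : even_part (zfun S) = 0.
Proof. by apply/funext => w; rewrite /even_part /zfun val_opp_pt subrr mul0r. Qed.

(** The product of two odd functions is even, hence a pullback. *)
Lemma odd_partM f g :
  pullback (even_part ((f - pullback (even_part f)) * (g - pullback (even_part g))))
  = (f - pullback (even_part f)) * (g - pullback (even_part g)).
Proof.
apply/funext => z; rewrite pullback_even_part !fctE !pullback_even_part opp_ptK.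
by field.
Qed.

Lemma pullback_rational a : rational_fun K a -> rational_fun S (pullback a).
Proof.
move=> [p [q [q0 aE]]]; exists (p \Po 'X^2), (q \Po 'X^2).
split=> z; rewrite !horner_comp !hornerXn; [exact: q0 (sq_pt z)|exact: aE].
Qed.

Lemma horner_even_odd (p : {poly R[i]}) z :
  p.[z] = (even_poly p).[z ^+ 2] + (odd_poly p).[z ^+ 2] * z.
Proof. by rewrite -[p in LHS]poly_even_odd !hornerE !horner_comp !hornerE. Qed.

(** The polynomial N with N(z^2) = q(z) q(-z), that is, the norm of q(z) over
    the polynomials in z^2. *)
Definition norm_poly (q : {poly R[i]}) : {poly R[i]} :=
  even_poly q ^+ 2 - 'X * odd_poly q ^+ 2.

Lemma horner_norm_poly q z : (norm_poly q).[z ^+ 2] = q.[z] * q.[- z].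
Proof.
rewrite !(horner_even_odd q) sqrrN /norm_poly !hornerE /=; ring.
Qed.

Lemma norm_poly_neq0 q :
  (forall z : S, q.[val z] != 0) -> forall w : K, (norm_poly q).[val w] != 0.
Proof.
move=> q0 w; rewrite -(sqrt_ptK w) val_sq_pt horner_norm_poly mulf_neq0//.
by rewrite -val_opp_pt.
Qed.

(** Clearing denominators by [norm_poly q], the even part of p(z) q(-z) is the
    product of the even parts of p and q minus that of their odd parts. *)
Lemma even_part_rational f : rational_fun S f -> rational_fun K (even_part f).
Proof.
move=> [p [q [q0 fE]]].
exists (even_poly p * even_poly q - 'X * (odd_poly p * odd_poly q)), (norm_poly q).
split=> w; first exact: norm_poly_neq0.
rewrite -(sqrt_ptK w); set z := sqrt_pt w.
rewrite -[even_part f _]/(pullback (even_part f) z) pullback_even_part !fE.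
rewrite val_sq_pt val_opp_pt horner_norm_poly.
have := q0 z; have := q0 (opp_pt z); rewrite val_opp_pt.
rewrite !(horner_even_odd p) !(horner_even_odd q) sqrrN !hornerE /= => qN0 qP0.
by field; rewrite qN0 qP0.
Qed.


(** p(z) / q(z) = p(z) q(-z) / N(z^2), where N = [norm_poly q] has no zero on [K]:
    the numerator is a polynomial on a bounded set, and 1 / N is a rational
    function on [K]. *)
Lemma sqrt_rational_bounded : rational_bounded K -> rational_bounded S.
Proof.
move=> Kb f [p [q [q0 fE]]].
have [M zM] : nc_bounded (zfun S).
  have [M KM] := Kb _ (rational_polyfun K 'X).
  (* |z| <= max 1 |z|^2 <= 1 + M *)
  exists (1 + M) => z; have := KM (sq_pt z).
  rewrite /polyfun hornerX val_sq_pt expr2 ncM /zfun.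
  have := nc_ge0 (val z); move: (nc _) => t t0 tM.
  have [t1|/ltW t1] := leP t 1.
    by rewrite (le_trans t1)// lerDl (le_trans _ tM)// mulr_ge0.
  by rewrite (@le_trans _ _ (t * t)) ?ler_peMr// (le_trans tM)// lerDr.
have polyb : forall r : {poly R[i]}, nc_bounded (polyfun r : S -> R[i]).
  elim/poly_ind => [|r c [N rN]].
    by exists 0 => z; rewrite /polyfun horner0 nc0.
  exists (N * M + nc c) => z; rewrite /polyfun !hornerE.
  by rewrite (le_trans (ncD _ _))// lerD2r ncM ler_pM ?nc_ge0//; [exact: rN|exact: zM].
have [N1 b1] := polyb (p * (q \Po - 'X)).
have [N2 b2] : nc_bounded (fun w : K => 1 / (norm_poly q).[val w]).
  apply: Kb; exists 1, (norm_poly q); split=> w; last by rewrite hornerC.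
  exact: norm_poly_neq0.
exists (N1 * N2) => z; rewrite fE.
have -> : p.[val z] / q.[val z] =
    (p * (q \Po - 'X)).[val z] * (1 / (norm_poly q).[val (sq_pt z)]).
  rewrite val_sq_pt horner_norm_poly hornerM horner_comp !hornerE /=.
  have := q0 z; have := q0 (opp_pt z); rewrite val_opp_pt => qN0 qP0.
  by field; rewrite qN0 qP0.
rewrite ncM; apply: ler_pM; [exact: nc_ge0|exact: nc_ge0|exact: b1|exact: b2].
Qed.

Lemma even_part_RK f : RK S f -> RK K (even_part f).
Proof.
move: f; apply: (@uniform_closure_map _ _ _ _ _ _ 1) => [f g e fg w|f Sf].
  rewrite mul1r /even_part -mulrBl opprD addrACA.
  by rewrite (le_trans (nc_half _ _))// ler_pdivrMr// mulr_natr mulr2n lerD.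
exact/uniform_closure_sub/even_part_rational.
Qed.

Lemma uniform_closure_pullback (A : set (K -> R[i])) (B : set (S -> R[i])) a :
  (forall b, A b -> uniform_closure B (pullback b)) ->
  uniform_closure A a -> uniform_closure B (pullback a).
Proof.
move=> AB; move: a; apply: (@uniform_closure_map _ _ _ _ _ _ 1) => // a b e ab z.
by rewrite mul1r; exact: ab.
Qed.

Lemma pullback_RK a : RK K a -> RK S (pullback a).
Proof.
apply: uniform_closure_pullback => b Kb.
exact/uniform_closure_sub/pullback_rational.
Qed.

Lemma continuous_sq_pt : continuous sq_pt.
Proof.
apply: continuous_comp_initial.
have -> : set_val \o sq_pt = (fun x : R[i] => x ^+ 2) \o set_val.
  by apply/funext => z.
move=> z; apply: continuous_comp; first exact: initial_continuous.
by apply: (@continuousM _ _ id id); exact: cvg_id.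
Qed.

Context (K0 : K 0).
Local Notation o := (origin K0).
Local Notation s := (origin (sqrt_set0 K0)).

Lemma sq_pt0 : sq_pt s = o.
Proof. by apply: val_inj; rewrite val_sq_pt /= expr0n. Qed.

Lemma sqrt_pt0 : sqrt_pt o = s.
Proof. by apply: val_inj; rewrite /= sqrtC0. Qed.

Lemma opp_pt0 : opp_pt s = s.
Proof. by apply: val_inj; rewrite /= oppr0. Qed.

Lemma even_part0 f : even_part f o = f s.
Proof.
by rewrite /even_part sqrt_pt0 opp_pt0; field.
Qed.

Lemma pullback_Jideal a : Jideal (RK K) o a -> Jideal (RK S) s (pullback a).
Proof.
move=> [Ka a0]; split; first exact: pullback_RK.
have := @continuous_sq_pt s; rewrite /continuous_at sq_pt0 => c; exact: (c _ a0).
Qed.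

End SquareRoot.

(** * Powers of the maximal ideal *)

Section ClosedIdeal.
Context {R : realType} (K : set R[i]) (x : K).
Context (Kb : rational_bounded K).
Local Notation I := (uniform_closure (Jideal (RK K) x)).
Implicit Types f g : K -> R[i].

Lemma closure_Jideal_RK f : I f -> RK K f.
Proof.
move: f; apply: (@uniform_closure_map _ _ _ _ _ id 1) => [f g e fg y|f [Kf _]//].
by rewrite mul1r; exact: fg.
Qed.

Lemma closure_JidealD f g : I f -> I g -> I (f + g).
Proof.
apply: uniform_closureD => u v [Ku u0] [Kv v0]; split; first exact: RKD.
by near=> y; rewrite fctE (near u0 y)// (near v0 y)// addr0.
Unshelve. all: by end_near. Qed.

Lemma closure_JidealM f g : RK K f -> I g -> I (f * g).
Proof.
move=> Kf; apply: uniform_closureMl => [|u [Ku u0]]; first exact: RK_bounded.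
apply: uniform_closure_sub; split; first exact: RKM.
by near=> y; rewrite fctE (near u0 y)// mulr0.
Unshelve. all: by end_near. Qed.

Lemma closure_Jideal0 : I 0.
Proof.
apply: uniform_closure_sub; split; last by near=> y.
rewrite -[0](_ : polyfun 0 = 0); first exact: RK_polyfun.
by apply/funext => y; rewrite /polyfun horner0.
Unshelve. all: by end_near. Qed.

Lemma MidealM f g : Mideal (RK K) x f -> Mideal (RK K) x g ->
  Mideal (RK K) x (f * g).
Proof.
by move=> [Kf f0] [Kg g0]; split; [exact: RKM|rewrite fctE f0 mul0r].
Qed.

Lemma MidealD f g : Mideal (RK K) x f -> Mideal (RK K) x g ->
  Mideal (RK K) x (f + g).
Proof.
by move=> [Kf f0] [Kg g0]; split; [exact: RKD|rewrite fctE f0 g0 addr0].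
Qed.

End ClosedIdeal.

Section ParityReduction.
Context {R : realType} (K : set R[i]) (K0 : K 0).
Context (Kb : rational_bounded K).
Local Notation S := (sqrt_set K).
Local Notation o := (origin K0).
Local Notation s := (origin (sqrt_set0 K0)).
Local Notation JK := (uniform_closure (Jideal (RK K) o)).
Local Notation JS := (uniform_closure (Jideal (RK S) s)).
Local Notation MK := (Mideal (RK K) o).
Local Notation MS := (Mideal (RK S) s).
Let Sb : rational_bounded S := sqrt_rational_bounded Kb.

Lemma closure_Jideal_pullback a : JK a -> JS (pullback a).
Proof.
apply: uniform_closure_pullback => b Jb.
exact/uniform_closure_sub/pullback_Jideal.
Qed.

Lemma even_part_Mideal f : MS f -> MK (even_part f).
Proof. by move=> [Sf f0]; split; [exact: even_part_RK|rewrite even_part0]. Qed.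

Lemma odd_part_Mideal f : MS f -> MS (f - pullback (even_part f)).
Proof.
move=> [Sf f0]; split; first exact/RKB/pullback_RK/even_part_RK.
by rewrite !fctE f0 sub0r /pullback /= sq_pt0 even_part0 f0 oppr0.
Qed.

(** Induction on the number [n] of pairs not yet treated, the general [h]
    absorbing the odd parts left over. One pair contributes
    F G = (F_e G_e + F_o G_o) + F_e G_o + G_e F_o, and each of the three terms
    provides one more factor from M_0(R(K)). *)
Lemma closure_Jideal_prod (m n k : nat) (F G : nat -> S -> R[i])
    (a : nat -> K -> R[i]) (h : S -> R[i]) :
  (forall b : nat -> K -> R[i], (forall i, MK (b i)) -> JK (\prod_(i < m) b i)) ->
  (n + k)%N = m -> (forall i, MS (F i)) -> (forall i, MS (G i)) ->
  (forall i, MK (a i)) -> RK S h ->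
  JS (h * pullback (\prod_(i < k) a i) * \prod_(i < n) (F i * G i)).
Proof.
move=> Hm + MF MG; elim: n k a h => [|n IH] k a h /= nkm Ma Sh.
  rewrite big_ord0 mulr1; apply: closure_JidealM => //.
  by apply: closure_Jideal_pullback; rewrite -nkm in Hm; exact: Hm.
rewrite big_ord_recr /=.
pose e f := even_part (f : S -> R[i]); pose o_ f := f - pullback (e f).
pose ext c i := if i is j.+1 then a j else c : K -> R[i].
have extM c : MK c -> forall i, MK (ext c i) by move=> Mc [|j] //=.
have step c u : MK c -> RK S u ->
    JS (h * u * pullback (\prod_(i < k.+1) ext c i) * \prod_(i < n) (F i * G i)).
  move=> Mc Su; apply: IH; [by rewrite addnS -addSn|exact: extM|exact: RKM].
have MFn := MF n; have MGn := MG n.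
have eF := even_part_Mideal MFn; have eG := even_part_Mideal MGn.
have oF := odd_part_Mideal MFn; have oG := odd_part_Mideal MGn.
have oo : MK (e (o_ (F n) * o_ (G n))) by apply: even_part_Mideal; exact: MidealM.
(* the terms F_e G_e + F_o G_o, F_e G_o and G_e F_o *)
have J1 := step _ _ (MidealD (MidealM Kb eF eG) oo) (@RK1 _ _).
have J2 := step _ _ eF oG.1.
have J3 := step _ _ eG oF.1.
have := closure_JidealD (closure_JidealD J1 J2) J3.
congr JS; rewrite !big_ord_recl /=.
have pD b c : pullback (b + c) = pullback b + pullback c :> (S -> R[i]) by [].
have pM b c : pullback (b * c) = pullback b * pullback c :> (S -> R[i]) by [].
rewrite mulr1 !(pM _ (\prod_(i < k) _)) pD pM odd_partM.
move: (\prod_(i < n) _) (pullback (\prod_(i < k) _)) => Q P.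
by apply/funext => z; rewrite !fctE; ring.
Qed.

Lemma ideal_pow_sqrt m : (0 < m)%N ->
  ideal_pow MK m `<=` closure_in (RK K) (Jideal (RK K) o) ->
  ideal_pow MS (2 * m) `<=` closure_in (RK S) (Jideal (RK S) s).
Proof.
move=> m0 Hm f [n [c [g [Mg ->]]]].
suff H : JS (\sum_(i < n) c i *: \prod_(j < 2 * m) g i j).
  by split => //; exact: (closure_Jideal_RK H).
apply: (big_ind JS); [exact: closure_Jideal0|exact: closure_JidealD|move=> i _].
rewrite scale_polyfun; apply: closure_JidealM => //; first exact: RK_polyfun.
have m20 : (0 < 2 * m)%N by rewrite muln_gt0.
(* the default value for indices out of range keeps G j in MS for every j *)
pose G j := g i (insubd (Ordinal m20) j).
have -> : \prod_(j < 2 * m) g i j = \prod_(j < m) (G (2 * j)%N * G (2 * j).+1).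
  transitivity (\prod_(j < 2 * m) G j).
    by apply: eq_bigr => j _; rewrite /G valKd.
  elim: (m) => [|p IH]; first by rewrite muln0 !big_ord0.
  by rewrite mulnS !addSn add0n !big_ord_recr /= IH mulrA.
have := @closure_Jideal_prod m m 0 (fun j => G (2 * j)%N) (fun j => G (2 * j).+1)
  (fun=> 0) 1.
rewrite big_ord0 [1 * _]mul1r mul1r; apply=> //.
- move=> b Mb; have [] // := Hm (\prod_(i < m) b i).
  exists 1%N, (fun=> 1), (fun _ => b); split=> //.
  by rewrite big_ord1 scale1r.
- exact: addn0.
- by move=> j; exact: Mg.
- by move=> j; exact: Mg.
- by move=> j; split => //; exact: (closure_Jideal_RK (@closure_Jideal0 _ _ o)).
- exact: RK1.
Qed.

End ParityReduction.

(** * Bounded functionals on R(K) *)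

Section BoundedFunctionals.
Context {R : realType} (K : set R[i]) (x0 : K).
Context (Kb : rational_bounded K).
Implicit Types (d e : (K -> R[i]) -> R[i]) (f g : K -> R[i]).
Local Notation A := (RK K).

Lemma linear_onB d f g : linear_on A d -> A f -> A g -> d (f - g) = d f - d g.
Proof.
by move=> dl Af Ag; rewrite addrC -scaleN1r dl// mulN1r addrC.
Qed.

Lemma linear_onD d f g : linear_on A d -> A f -> A g -> d (f + g) = d f + d g.
Proof. by move=> dl Af Ag; rewrite -[f]scale1r dl// mul1r scale1r. Qed.

Lemma linear_on0 d : linear_on A d -> d 0 = 0.
Proof.
by move=> dl; rewrite -[0 in LHS](subrr (1 : K -> R[i])) linear_onB ?subrr//; exact: RK1.
Qed.

Lemma linear_onZ d a f : linear_on A d -> A f -> d (a *: f) = a * d f.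
Proof.
move=> dl Af; rewrite -[_ *: f]addr0 dl// ?linear_on0 ?addr0//.
by rewrite -(subrr (1 : K -> R[i])); apply: RKB => //; exact: RK1.
Qed.

Lemma linear_on_lin d e a b : linear_on A d -> linear_on A e ->
  linear_on A (fun f => a * d f + b * e f).
Proof. by move=> dl el c f g Af Ag; rewrite dl// el//; ring. Qed.

Lemma linear_on_sum (n : nat) (d : 'I_n -> (K -> R[i]) -> R[i]) (a : 'I_n -> R[i]) :
  (forall i, linear_on A (d i)) -> linear_on A (fun f => \sum_(i < n) d i f * a i).
Proof.
move=> dl c f g Af Ag; rewrite mulr_sumr -big_split /=; apply: eq_bigr => i _.
by rewrite dl//; ring.
Qed.

Lemma supnorm_ge0 f : A f -> 0 <= supnorm f.
Proof.
move=> Af; apply: (le_trans (nc_ge0 (f x0))); apply: nc_le_supnorm.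
exact: RK_bounded.
Qed.

Lemma supnormM f g : A f -> A g -> supnorm (f * g) <= supnorm f * supnorm g.
Proof.
move=> Af Ag; apply: supnorm_le => // x; rewrite fctE ncM.
by apply: ler_pM; rewrite ?nc_ge0//; apply: nc_le_supnorm; exact: RK_bounded.
Qed.

Lemma bounded_on_pos d : bounded_on A d ->
  exists2 M : R, 0 <= M & forall f, A f -> nc (d f) <= M * supnorm f.
Proof.
move=> [M dM]; exists `|M| => // f Af; apply: (le_trans (dM f Af)).
by rewrite ler_wpM2r ?supnorm_ge0// ler_norm.
Qed.

Lemma bounded_on_lin d e a b : bounded_on A d -> bounded_on A e ->
  bounded_on A (fun f => a * d f + b * e f).
Proof.
move=> [M dM] [N eN]; exists (nc a * M + nc b * N) => f Af.
rewrite (le_trans (ncD _ _))// !ncM mulrDl -!mulrA.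
by apply: lerD; apply: ler_wpM2l; rewrite ?nc_ge0 ?dM ?eN.
Qed.

Lemma bounded_on_sum (n : nat) (d : 'I_n -> (K -> R[i]) -> R[i]) (a : 'I_n -> R[i]) :
  (forall i, bounded_on A (d i)) -> bounded_on A (fun f => \sum_(i < n) d i f * a i).
Proof.
elim: n d a => [|n IH] d a db.
  by exists 0 => f _; rewrite big_ord0 nc0 mul0r.
pose w := widen_ord (leqnSn n).
have [M MP] := IH (d \o w) (a \o w) (fun i => db _).
have [N NP] := db ord_max.
exists (M + N * nc (a ord_max)) => f Af.
rewrite big_ord_recr /= (le_trans (ncD _ _))// mulrDl lerD ?MP// ncM mulrAC.
by rewrite ler_wpM2r ?nc_ge0 ?NP.
Qed.

(** Density of the rational functions in [RK K]. *)
Lemma bounded_functional_eq0 d : linear_on A d -> bounded_on A d ->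
  (forall f, rational_fun K f -> d f = 0) -> forall f, A f -> d f = 0.
Proof.
move=> dl /bounded_on_pos[M M0 dM] d0 f Af.
apply: ComplexField.Normc.eq0_normc; apply/eqP; rewrite eq_le nc_ge0 andbT.
apply/ler_addgt0Pr => e e0; rewrite add0r.
have M1 : 0 < M + 1 by rewrite ltr_wpDl.
have [g Kg fg] := (iffLR (uniform_closureP _ _) Af) (e / (M + 1)) (divr_gt0 e0 M1).
have Ag : A g by exact: uniform_closure_sub.
rewrite -[d f]subr0 -(d0 g Kg) -linear_onB//.
rewrite (le_trans (dM _ _))//; first exact: RKB.
apply: (@le_trans _ _ (M * (e / (M + 1)))).
  by rewrite ler_wpM2l//; apply: supnorm_le.
by rewrite mulrA ler_pdivrMr// mulrC ler_pM2l// lerDl.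
Qed.

End BoundedFunctionals.

(** * From a derivation to Taylor coefficients *)

(** Bounded extensions to [RK K] of the Taylor coefficients at [o] of order at
    most [m]. They are characterised by the shift rule rather than by
    derivatives of p / q, which the function p / q on [K] need not determine
    when [K] is small. *)
Record taylor_system (R : realType) (K : set R[i]) (o : K) (m : nat)
    (c : nat -> (K -> R[i]) -> R[i]) : Prop := TaylorSystem {
  taylor_linear : forall k, (k <= m)%N -> linear_on (RK K) (c k);
  taylor_bounded : forall k, (k <= m)%N -> bounded_on (RK K) (c k);
  taylor_eval : forall f, RK K f -> c 0%N f = f o;
  taylor_one : forall k, (0 < k <= m)%N -> c k 1 = 0;
  taylor_shift : forall k f, (k < m)%N -> RK K f -> c k.+1 (zfun K * f) = c k f
}.

Section DerivationToTaylor.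
Context {R : realType} (K : set R[i]) (K0 : K 0).
Context (Kb : rational_bounded K).
Local Notation o := (origin K0).
Local Notation z := (zfun K).
Context (m : nat) (d : nat -> (K -> R[i]) -> R[i]).
Context (dP : point_derivation (RK K) (fun f => f o) m d).
Context (db : bounded_derivation (RK K) m d).
Implicit Types f g : K -> R[i].

Let d_lin k : (k <= m)%N -> linear_on (RK K) (d k).
Proof. by case: dP => + _ _; exact. Qed.

Let d_eval f : RK K f -> d 0%N f = f o.
Proof. by case: dP => _ + _; exact. Qed.

Let leibniz k f g : (k <= m)%N -> RK K f -> RK K g ->
  d k (f * g) = \sum_(j < k.+1) d j f * d (k - j)%N g.
Proof.
case: k => [_ Kf Kg|k km]; last by case: dP => _ _ + Kf Kg; apply.
by rewrite big_ord1 !d_eval//; exact: RKM.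
Qed.

(** From d_k (1 * 1) = 2 d_k 1 + (terms that vanish by induction). *)
Lemma derivation_one k : (0 < k <= m)%N -> d k 1 = 0.
Proof.
elim/ltn_ind: k => -[//|k] IH /= km.
have := leibniz km (@RK1 _ K) (@RK1 _ K).
rewrite mulr1 big_ord_recl big_ord_recr /= subn0 subnn.
rewrite big1 ?add0r => [|i _]; last first.
  rewrite /bump /= add1n IH ?mul0r//= ?ltnS//.
  by rewrite (ltn_trans (ltn_ord i)).
rewrite d_eval ?mul1r; last exact: RK1.
by rewrite mulr1 => /eqP; rewrite -[X in X == _]addr0 (inj_eq (addrI _)) eq_sym => /eqP.
Qed.

Lemma RK_zX i : RK K (z ^+ i).
Proof. by rewrite -polyfunXn; exact: RK_polyfun. Qed.

Lemma derivation_z0 f : RK K f -> d 0%N (z * f) = 0.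
Proof. by move=> Kf; rewrite d_eval ?fctE ?mul0r//; apply: RKM => //; exact: RKz. Qed.

Lemma derivation_mulz k f : (k.+1 <= m)%N -> RK K f ->
  d k.+1 (z * f) = \sum_(j < k.+1) d j.+1 z * d (k - j)%N f.
Proof.
move=> km Kf; rewrite leibniz//; last exact: RKz.
rewrite big_ord_recl /= d_eval; last exact: RKz.
by rewrite [z o]/= mul0r add0r.
Qed.

(** z^i f vanishes to order i at 0, so its coefficients below i are zero. *)
Lemma derivation_zX_eq0 k i f : (k <= m)%N -> (k < i)%N -> RK K f ->
  d k (z ^+ i * f) = 0.
Proof.
elim: i k f => // i IH k f km ki Kf; rewrite exprS -mulrA.
have Kzf : RK K (z ^+ i * f) by apply: RKM => //; exact: RK_zX.
case: k km ki => [|k] km ki; first exact: derivation_z0.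
rewrite derivation_mulz// big1// => j _; rewrite IH ?mulr0//.
  by rewrite (leq_trans (leq_subr _ _))// ltnW.
by rewrite (leq_ltn_trans (leq_subr _ _)).
Qed.

Lemma derivation_zX_diag k : (k <= m)%N -> d k (z ^+ k) = d 1%N z ^+ k.
Proof.
elim: k => [_|k IH km]; first by rewrite !expr0 d_eval//; exact: RK1.
rewrite exprS derivation_mulz//; last exact: RK_zX.
rewrite big_ord_recl /= subn0 IH; last exact: ltnW.
rewrite big1 ?addr0 ?exprS// => j _; rewrite /bump /= add1n -[z ^+ k]mulr1.
rewrite derivation_zX_eq0 ?mulr0//; last exact: RK1.
  by rewrite (leq_trans (leq_subr _ _))// ltnW.
by rewrite ltn_subrL /=; exact: leq_ltn_trans (leq0n j) (ltn_ord j).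
Qed.

(** If d_1 z = 0, then d_1 kills polynomials, hence by the Leibniz rule for
    q f = p also quotients, hence by density everything. *)
Lemma derivation_z_neq0 : (0 < m)%N -> Defs.nondegenerate (RK K) d -> d 1%N z != 0.
Proof.
move=> m0 [f Kf]; apply: contra_neq => u0.
have d1 : linear_on (RK K) (d 1%N) by exact: d_lin.
have dp p : d 1%N (polyfun p) = 0.
  elim/poly_ind: p => [|p c IH].
    by rewrite polyfunC; exact: linear_on0.
  rewrite polyfunD polyfunM polyfunX mulrC linear_onD//; last exact: RK_polyfun.
    rewrite derivation_mulz ?big_ord1 ?u0 ?mul0r ?add0r//; last exact: RK_polyfun.
    rewrite -[polyfun _]mulr1 -scale_polyfun linear_onZ//; last exact: RK1.
    by rewrite derivation_one// mulr0.
  by apply: RKM => //; [exact: RKz|exact: RK_polyfun].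
apply: (bounded_functional_eq0 o Kb d1 (db m0)) => // {Kf}f Kf'.
have Kf : RK K f by exact: uniform_closure_sub.
case: Kf' => p [q [q0 fE]].
have := dp p; have -> : polyfun p = polyfun q * f.
  by apply/funext => x; rewrite /polyfun fctE fE mulrC divfK.
rewrite leibniz//; last exact: RK_polyfun.
rewrite !big_ord_recl big_ord0 /= dp mul0r !addr0 subn0 d_eval; last exact: RK_polyfun.
by move/eqP; rewrite mulf_eq0 (negPf (q0 o)) => /eqP.
Qed.

Context (u0 : d 1%N z != 0).

(** Induction on the order: c_(n+1) is defined by solving
    d_(n+1) f = \sum_(i <= n+1) c_i f * d_(n+1) (z^i) for its last term, whose
    factor d_(n+1) (z^(n+1)) = (d_1 z)^(n+1) is nonzero. *)
Lemma taylor_of_derivation n : (n <= m)%N ->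
  exists2 c, taylor_system o n c &
    forall k f, (k <= n)%N -> RK K f ->
      d k f = \sum_(i < k.+1) c i f * d k (z ^+ i).
Proof.
elim: n => [_|n IH nm].
  exists (fun _ => d 0%N); first split=> //.
  - by move=> k _; exact: d_lin.
  - by move=> k _; exact: db.
  - by move=> k; rewrite leqn0; case: k.
  - move=> k f; rewrite leqn0 => /eqP-> Kf; rewrite big_ord1 expr0 [d _ 1]d_eval ?mulr1//.
    exact: RK1.
have [c [cl cb c0 c1 cs] cd] := IH (ltnW nm).
pose U := d n.+1 (z ^+ n.+1).
have U0 : U != 0 by rewrite /U derivation_zX_diag// expf_neq0.
pose new f :=
  U^-1 * d n.+1 f + (- U^-1) * \sum_(i < n.+1) c i f * d n.+1 (z ^+ i).
pose c' k := if k == n.+1 then new else c k.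
have c'E k : (k <= n)%N -> c' k = c k by move=> kn; rewrite /c' ltn_eqF.
have c'S : c' n.+1 = new by rewrite /c' eqxx.
have new_d f : new f * U = d n.+1 f - \sum_(i < n.+1) c i f * d n.+1 (z ^+ i).
  by rewrite /new mulNr -mulrBr mulrC mulrA divff// mul1r.
exists c'; first split.
- move=> k; rewrite leq_eqVlt => /orP[/eqP->|kn]; last by rewrite c'E//; exact: cl.
  rewrite c'S; apply: linear_on_lin; first exact: d_lin.
  by apply: linear_on_sum => i; apply: cl; rewrite -ltnS.
- move=> k; rewrite leq_eqVlt => /orP[/eqP->|kn]; last by rewrite c'E//; exact: cb.
  rewrite c'S; apply: bounded_on_lin => //; first exact: db.
  by apply: bounded_on_sum => // i; apply: cb; rewrite -ltnS.
- by rewrite c'E.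
- move=> k /andP[k0]; rewrite leq_eqVlt => /orP[/eqP->|kn]; last first.
    by rewrite c'E// c1// k0.
  rewrite c'S /new derivation_one// mulr0 add0r big1 ?mulr0// => i _.
  case: i => -[|i] /= ilt; first by rewrite expr0 derivation_one// mulr0.
  by rewrite c1 ?mul0r.
- move=> k f; rewrite ltnS leq_eqVlt => /orP[/eqP->|kn] Kf; last first.
    by rewrite !c'E// ?cs// ltnW.
  (* shift rule at the new order: expand d_(n+1) (z f) by the Leibniz rule and
     each d_(n-j) f by the triangular relation, then recognise d_(n+1) (z^(i+1)) *)
  rewrite c'S c'E//; apply: (mulIf U0); rewrite new_d.
  have Kzf : RK K (z * f) by apply: RKM => //; exact: RKz.
  rewrite big_ord_recl /= [c 0%N _]c0// fctE [z o]/= mul0r mul0r add0r.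
  have -> : d n.+1 (z * f) = \sum_(i < n.+1) c i f * d n.+1 (z ^+ i.+1).
    rewrite derivation_mulz//.
    transitivity (\sum_(j < n.+1) \sum_(i < n.+1)
        c i f * (d j.+1 z * d (n - j)%N (z ^+ i))).
      apply: eq_bigr => j _; rewrite (cd (n - j)%N) ?leq_subr// mulr_sumr.
      (* the terms added beyond i = n - j vanish by derivation_zX_eq0 *)
      rewrite (big_ord_widen n.+1
        (fun i => d j.+1 z * (c i f * d (n - j)%N (z ^+ i)))) ?ltnS ?leq_subr//.
      rewrite big_mkcond /=.
      apply: eq_bigr => i _; case: ifPn => [_|]; first by rewrite mulrCA.
      rewrite -leqNgt => ji; rewrite -[z ^+ i]mulr1 derivation_zX_eq0 ?mulr0//.
        by rewrite (leq_trans (leq_subr _ _))// ltnW.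
      exact: RK1.
    rewrite exchange_big /=; apply: eq_bigr => i _.
    by rewrite -mulr_sumr exprS derivation_mulz//; exact: RK_zX.
  rewrite big_ord_recr /= -/U addrAC -[RHS]add0r; congr (_ + _).
  apply/eqP; rewrite subr_eq0; apply/eqP; apply: eq_bigr => i _.
  by rewrite /bump /= add1n cs.
move=> k f; rewrite leq_eqVlt => /orP[/eqP->|kn] Kf; last first.
  rewrite cd//; apply: eq_bigr => i _; rewrite c'E//.
  exact: leq_trans (ltn_ord i) kn.
rewrite big_ord_recr /= c'S -/U new_d addrC.
rewrite -[LHS](subrK (\sum_(i < n.+1) c i f * d n.+1 (z ^+ i))).
by congr (_ + _); apply: eq_bigr => i _; rewrite c'E// -ltnS.
Qed.

End DerivationToTaylor.

(** * From Taylor coefficients to a derivation *)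

(** A polynomial with nonzero constant term is invertible modulo 'X^m.+1. *)
Lemma coefM_cancel (F : fieldType) (q a : {poly F}) (m : nat) :
  q`_0 != 0 -> (forall k, (k <= m)%N -> (q * a)`_k = 0) ->
  forall k, (k <= m)%N -> a`_k = 0.
Proof.
move=> q0 qa k; elim/ltn_ind: k => k IH km.
have := qa k km; rewrite coefM big_ord_recl /= subn0 big1 ?addr0.
  by move/eqP; rewrite mulf_eq0 (negPf q0) => /eqP.
move=> j _; have jk := ltn_ord j; rewrite /bump /= add1n.
rewrite IH ?mulr0 ?(leq_trans (leq_subr _ _))//.
by rewrite ltn_subrL /=; exact: leq_ltn_trans (leq0n j) jk.
Qed.

Lemma bounded_on_comp (R : realType) (X Y : topologicalType)
    (A : set (X -> R[i])) (B : set (Y -> R[i])) (T : (X -> R[i]) -> Y -> R[i])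
    (d : (Y -> R[i]) -> R[i]) (N : R) :
  (exists2 M : R, 0 <= M & forall f, B f -> nc (d f) <= M * supnorm f) ->
  (forall f, A f -> B (T f)) ->
  (forall f, A f -> supnorm (T f) <= N * supnorm f) ->
  bounded_on A (d \o T).
Proof.
move=> [M M0 dM] AB TN; exists (M * N) => f Af.
by rewrite (le_trans (dM _ (AB _ Af)))// -mulrA ler_wpM2l// TN.
Qed.

Section TaylorToDerivation.
Context {R : realType} (K : set R[i]) (K0 : K 0).
Context (Kb : rational_bounded K).
Local Notation o := (origin K0).
Local Notation z := (zfun K).
Context (m : nat) (c : nat -> (K -> R[i]) -> R[i]).
Context (cP : taylor_system o m c).
Implicit Types f g : K -> R[i].

(** With this polynomial the Leibniz rule says that [taylor_poly] is
    multiplicative modulo 'X^m.+1. *)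
Definition taylor_poly g : {poly R[i]} := \poly_(i < m.+1) c i g.

Lemma coef_taylor_poly g k : (k <= m)%N -> (taylor_poly g)`_k = c k g.
Proof. by move=> km; rewrite coef_poly ltnS km. Qed.

(** The shift rule is the case p = 'X, from which Horner's scheme gives all
    polynomials. *)
Lemma taylor_polyfunM p g k : (k <= m)%N -> RK K g ->
  c k (polyfun p * g) = (p * taylor_poly g)`_k.
Proof.
move=> + Kg; elim/poly_ind: p k => [|p a IH] k km.
  have -> : polyfun 0 * g = 0 by apply/funext => x; rewrite fctE /polyfun horner0 mul0r.
  by rewrite mul0r coef0 (linear_on0 (taylor_linear cP km)).
have Kpg : RK K (polyfun p * g) by apply: RKM => //; exact: RK_polyfun.
have Kzpg : RK K (z * (polyfun p * g)) by apply: RKM => //; exact: RKz.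
rewrite polyfunD polyfunM polyfunX mulrDl [_ * z]mulrC -mulrA -scale_polyfun.
have cl := taylor_linear cP km.
rewrite (linear_onD cl)//; last exact: RKZ.
rewrite (linear_onZ Kb _ cl)// mulrDl coefD coefCM coef_taylor_poly//; congr (_ + _).
rewrite mulrAC coefMX; case: k km {cl} => [|k] km /=.
  by rewrite (taylor_eval cP)// fctE [z o]/= mul0r.
by rewrite (taylor_shift cP)// IH// ltnW.
Qed.

(** Let q f = p and let T be [taylor_poly]. Modulo 'X^m.+1,
    q T(f g) = T(p g) = p T(g) = q T(f) T(g), and q can be cancelled since
    q(0) <> 0. *)
Lemma taylor_rationalM f g k : rational_fun K f -> RK K g -> (k <= m)%N ->
  c k (f * g) = \sum_(j < k.+1) c j f * c (k - j)%N g.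
Proof.
move=> rf Kg km; have Kf : RK K f by exact: uniform_closure_sub.
have Kfg : RK K (f * g) by exact: RKM.
case: rf => p [q [q0 fE]].
have qf : polyfun q * f = polyfun p.
  by apply/funext => x; rewrite /polyfun fctE fE mulrC divfK.
pose A := taylor_poly (f * g) - taylor_poly f * taylor_poly g.
have qTf i : (i <= m)%N -> (q * taylor_poly f)`_i = p`_i.
  move=> im; rewrite -taylor_polyfunM// qf -[polyfun p]mulr1.
  rewrite taylor_polyfunM//; last exact: RK1.
  suff -> : taylor_poly 1 = 1 by rewrite mulr1.
  apply/polyP => j; rewrite coef_poly coef1; case: ifPn => [jm|].
    case: j jm => [|j] jm; first by rewrite (taylor_eval cP)//; exact: RK1.
    by rewrite (taylor_one cP).
  by case: j.
have : A`_k = 0.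
  apply: (@coefM_cancel _ q _ m) => //.
    by have := q0 o; rewrite /= horner_coef0.
  move=> i im; rewrite /A mulrBr mulrA coefB -taylor_polyfunM//.
  rewrite mulrA qf taylor_polyfunM// !coefM; apply/eqP; rewrite subr_eq0; apply/eqP.
  apply: eq_bigr => j _; rewrite qTf//.
  by rewrite (leq_trans _ im)// -ltnS.
rewrite /A coefB coef_taylor_poly// coefM => /eqP; rewrite subr_eq0 => /eqP->.
apply: eq_bigr => j _; have jk : (j <= k)%N by rewrite -ltnS.
rewrite !coef_taylor_poly ?(leq_trans (leq_subr _ _))//.
exact: leq_trans jk km.
Qed.

(** For fixed [g], the defect of the Leibniz rule is a bounded functional of [f]
    that vanishes on rational functions. *)
Lemma taylorM f g k : RK K f -> RK K g -> (k <= m)%N ->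
  c k (f * g) = \sum_(j < k.+1) c j f * c (k - j)%N g.
Proof.
move=> Kf Kg km; apply/eqP; rewrite -subr_eq0 -[X in X - _]mul1r -mulN1r; apply/eqP.
have jm (j : 'I_k.+1) : (j <= m)%N by rewrite (leq_trans _ km)// -ltnS.
pose D f := 1 * (c k \o (fun f => f * g)) f
  + -1 * \sum_(j < k.+1) c j f * c (k - j)%N g.
apply: (@bounded_functional_eq0 _ _ o Kb D) => //.
- apply: linear_on_lin; last by apply: linear_on_sum => j; exact: (taylor_linear cP).
  move=> a u v Ku Kv /=; rewrite mulrDl scale_polyfun -mulrA -scale_polyfun.
  by rewrite (taylor_linear cP km)//; exact: RKM.
- apply: bounded_on_lin => //; last first.
    by apply: bounded_on_sum => // j; exact: (taylor_bounded cP).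
  apply: (@bounded_on_comp _ _ _ _ (RK K) _ _ (supnorm g)).
  + apply: (bounded_on_pos o Kb); exact: (taylor_bounded cP).
  + by move=> u Ku; exact: RKM.
  + by move=> u Ku; rewrite [supnorm g * _]mulrC; exact: (supnormM o Kb).
- by move=> u ru; rewrite /D /= taylor_rationalM// mul1r mulN1r subrr.
Qed.

Lemma derivation_of_taylor : (0 < m)%N ->
  has_nondeg_bounded_derivation (RK K) m o.
Proof.
move=> m0; exists c; split.
- split; [exact: (taylor_linear cP)|exact: (taylor_eval cP)|].
  by move=> k f g /andP[_ km] Kf Kg; exact: taylorM.
- exact: (taylor_bounded cP).
- exists z; first exact: RKz.
  rewrite -[z]mulr1 (taylor_shift cP)//; last exact: RK1.
  by rewrite (taylor_eval cP) ?oner_neq0//; exact: RK1.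
Qed.

End TaylorToDerivation.

(** * Taylor coefficients on the square root *)

Section TaylorSquareRoot.
Context {R : realType} (K : set R[i]) (K0 : K 0).
Context (Kb : rational_bounded K).
Local Notation S := (sqrt_set K).
Local Notation o := (origin K0).
Local Notation s := (origin (sqrt_set0 K0)).
Local Notation z := (zfun S).
Context (m : nat) (c : nat -> (K -> R[i]) -> R[i]).
Context (cP : taylor_system o m c).

(** For k = 2j this is c_j (E f), and for k = 2j - 1 it is c_j (E (z f)): an odd
    coefficient of f is the next even coefficient of z f. *)
Definition sqrt_taylor k (f : S -> R[i]) : R[i] :=
  c (uphalf k) (even_part (z ^+ odd k * f)).

(** The shift rule from an even index to the next holds by definition; from an
    odd one it is the shift rule on [K], since E (z^2 f) = w E f. *)
Lemma sqrt_taylorP : taylor_system s (2 * m) sqrt_taylor.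
Proof.
have Sb := sqrt_rational_bounded Kb.
have hk k : (k <= 2 * m)%N -> (uphalf k <= m)%N.
  by rewrite leq_uphalf_double -mul2n.
have SzX (b : bool) : RK S (z ^+ b).
  by case: b; [exact: RKz|exact: RK1].
have Szf (b : bool) f : RK S f -> RK S (z ^+ b * f) by move=> Sf; exact: RKM.
have Ez f : even_part (z * (z * f)) = zfun K * even_part f.
  by rewrite mulrA -even_partM pullback_z expr2.
split.
- move=> k /hk km a f g Sf Sg; rewrite /sqrt_taylor mulrDr.
  rewrite scale_polyfun mulrCA -scale_polyfun even_part_linear.
  by rewrite (taylor_linear cP km)//; apply: even_part_RK => //; exact: Szf.
- move=> k /hk km.
  apply: (@bounded_on_comp _ _ _ _ (RK K)
    (fun f => even_part (z ^+ odd k * f)) _ (supnorm (z ^+ odd k))).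
  + exact: (bounded_on_pos o Kb (taylor_bounded cP km)).
  + by move=> f Sf; apply: even_part_RK => //; exact: Szf.
  + move=> f Sf; apply: le_trans (supnormM s Sb (SzX _) Sf).
    have Bf := RK_bounded Sb (Szf (odd k) _ Sf).
    apply: (supnorm_le o) => w; rewrite (le_trans (nc_half _ _))//.
    by rewrite ler_pdivrMr// mulr_natr mulr2n lerD// nc_le_supnorm.
- move=> f Sf; rewrite /sqrt_taylor /= expr0 mul1r (taylor_eval cP) ?even_part0//.
  exact: even_part_RK.
- move=> k /andP[k0 /hk km]; rewrite /sqrt_taylor mulr1.
  case: (boolP (odd k)) => kodd /=.
    by rewrite expr1 even_part_z (linear_on0 (taylor_linear cP km)).
  rewrite expr0 -[1](_ : pullback 1 = 1 :> (S -> R[i]))//.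
  rewrite even_part_pullback (taylor_one cP)// km andbT.
  by case: k k0 {km kodd} => // -[].
- move=> k f km Sf; rewrite /sqrt_taylor /=.
  case: (boolP (odd k)) => kodd /=; rewrite ?expr0 ?expr1 ?mul1r.
    by rewrite uphalf_half kodd.
  rewrite Ez uphalf_half (negPf kodd) (taylor_shift cP)//.
    by rewrite ltn_half_double -mul2n.
  exact: even_part_RK.
Qed.

End TaylorSquareRoot.

Theorem theorem1p7 (R : realType) (K : set R[i]) (cK : compact K) (K0 : K 0)
    (m : nat) (m_gt0 : (0 < m)%N) :
  let S := sqrt_set K in
  let o := origin K0 in
  let s := origin (sqrt_set0 K0) in
  [/\ closure_in (RK K) (Jideal (RK K) o) (zfun K ^+ m) ->
      closure_in (RK S) (Jideal (RK S) s) (zfun S ^+ (2 * m)),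
      ideal_pow (Mideal (RK K) o) m
        `<=` closure_in (RK K) (Jideal (RK K) o) ->
      ideal_pow (Mideal (RK S) s) (2 * m)
        `<=` closure_in (RK S) (Jideal (RK S) s)
    & has_nondeg_bounded_derivation (RK K) m o ->
      has_nondeg_bounded_derivation (RK S) (2 * m) s].
Proof.
move=> S o s; have Kb := compact_rational_bounded cK.
have Sb := sqrt_rational_bounded Kb.
split=> [[_ Jz]||[d [dP db dnd]]].
- split; first exact: RK_zX.
  have -> : zfun S ^+ (2 * m) = pullback (zfun K ^+ m).
    by apply/funext => x; rewrite exprM -pullback_z /pullback /= !fctE.
  exact: closure_Jideal_pullback.
- exact: ideal_pow_sqrt.
- have u0 := derivation_z_neq0 Kb dP db m_gt0 dnd.
  have [c cP _] := taylor_of_derivation Kb dP db u0 (leqnn m).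
  apply: (derivation_of_taylor Sb (sqrt_taylorP Kb cP)).
  by rewrite muln_gt0.
Qed.
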